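(* Let $g\in C(\partial\Omega)$. For each $\gamma\ge0$, let $u_\gamma\in C(\bar\Omega)$ denote the unique viscosity solution of the problem $$-\Delta_\infty u_\gamma=\gamma\ \text{ in }\Omega,\qquad u_\gamma=g\ \text{ on }\partial\Omega.$$ There exists a constant $C>0$, depending only on $\operatorname{diam}(\Omega)$, such that $$\|u_\gamma-u_0\|_{L^\infty(\bar\Omega)}\le C\gamma^{1/3}\big(1+\|g\|_{L^\infty(\partial\Omega)}\big).$$
   Context: $\Omega\subseteq\mathbb{R}^n$ is a bounded, connected, open set. It is assumed that $\operatorname{diam}(\Omega):=\sup\{d(x,y):x,y\in\bar\Omega\}<\infty$, where $d(x,y)$ is the infimum of the lengths of Lipschitz paths in $\bar\Omega$ joining $x$ to $y$. Here $-\Delta_\infty u=-|Du|^{-2}\langle D^2u\,Du,Du\rangle$ is the normalized infinity Laplacian, understood in the viscosity sense as follows. For a $C^2$ function $\varphi$ near $x$: if $D\varphi(x)\ne0$, $\Delta_\infty^+\varphi(x)=\Delta_\infty^-\varphi(x):=|D\varphi(x)|^{-2}\langle D^2\varphi(x)D\varphi(x),D\varphi(x)\rangle$; if $D\varphi(x)=0$, $\Delta_\infty^+\varphi(x):=\max_{|v|=1}\langle D^2\varphi(x)v,v\rangle$ and $\Delta_\infty^-\varphi(x):=\min_{|v|=1}\langle D^2\varphi(x)v,v\rangle$. A continuous $u$ is a viscosity solution of $-\Delta_\infty u=\gamma$ in $\Omega$ if for every polynomial $\varphi$ of degree 2 and $x_0\in\Omega$: $-\Delta_\infty^+\varphi(x_0)\le\gamma$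 whenever $u-\varphi$ has a strict local maximum at $x_0$, and $-\Delta_\infty^-\varphi(x_0)\ge\gamma$ whenever $u-\varphi$ has a strict local minimum at $x_0$. (Equivalently, one may use all $\varphi\in C^2$ and possibly non-strict local extrema.) For each constant $\gamma\ge0$ the Dirichlet problem has a unique viscosity solution in $C(\bar\Omega)$.
   Formalization: The estimate is proved for 0 ≤ γ ≤ 1 only: for all γ ≥ 0 it is false, since on Ω = (−1,1) with g = 0 one has ‖u_γ − u_0‖ = γ/2, which exceeds Cγ^{1/3} for large γ; any other fixed upper bound on γ follows by scaling. *)

(* Defs.v *)
From mathcomp Require Import all_boot all_order all_algebra.
From mathcomp Require Import all_classical all_reals all_analysis.

Set Implicit Arguments.
Unset Strict Implicit.
Unset Printing Implicit Defensive.

Import Order.TTheory GRing.Theory Num.Theory.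
Import numFieldNormedType.Exports.

Local Open Scope classical_set_scope.
Local Open Scope ring_scope.

(* The library norm `|x| on row vectors is the sup norm: it induces the
   Euclidean topology, but lengths and unit vectors need the inner product. *)
Definition dotv (R : realType) (n : nat) (x y : 'rV[R]_n) : R :=
  \sum_(i < n) x 0 i * y 0 i.

Definition enorm (R : realType) (n : nat) (x : 'rV[R]_n) : R :=
  Num.sqrt (dotv x x).

Definition boundary (T : topologicalType) (A : set T) : set T :=
  closure A `\` interior A.

(* For a continuous function on a nonempty compact set, this real supremum is
   the L^oo norm of the statement. *)
Definition supnorm (T : Type) (R : realType) (A : set T) (f : T -> R) : R :=
  sup [set `|f x| | x in A].

(* Length of p on [0, 1]: the supremum of the Euclidean lengths of the inscribed
   polygons, as in the scalar-valued [variation] and [total_variation]. *)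
Definition polygon_length (R : realType) (n : nat) (p : R -> 'rV[R]_n)
    (s : seq R) : R :=
  let F := p \o nth 1 (0 :: s) in
  \sum_(0 <= k < size s) enorm (F k.+1 - F k).

Definition path_length (R : realType) (n : nat) (p : R -> 'rV[R]_n) : \bar R :=
  ereal_sup [set (polygon_length p s)%:E | s in itv_partition 0 1].

Definition lipschitz_path (R : realType) (n : nat) (A : set 'rV[R]_n.+1)
    (x y : 'rV[R]_n.+1) (p : R -> 'rV[R]_n.+1) : Prop :=
  [/\ exists k : R, k.-lipschitz_`[0, 1] p,
      forall t : R, 0 <= t <= 1 -> A (p t),
      p 0 = x & p 1 = y].

(* Equal to +oo when no Lipschitz path in A joins x to y. *)
Definition path_dist (R : realType) (n : nat) (A : set 'rV[R]_n.+1)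
    (x y : 'rV[R]_n.+1) : \bar R :=
  ereal_inf [set path_length p | p in lipschitz_path A x y].

Definition path_diam (R : realType) (n : nat) (Omega : set 'rV[R]_n.+1) :
    \bar R :=
  ereal_sup [set d | exists x y, [/\ closure Omega x, closure Omega y
                                  & d = path_dist (closure Omega) x y]].

Definition partial (R : realType) (n : nat) (i : 'I_n.+1)
    (phi : 'rV[R]_n.+1 -> R) (x : 'rV[R]_n.+1) : R :=
  'D_(delta_mx 0 i) phi x.

Definition grad (R : realType) (n : nat) (phi : 'rV[R]_n.+1 -> R)
    (x : 'rV[R]_n.+1) : 'rV[R]_n.+1 :=
  \row_i partial i phi x.

Definition hessian (R : realType) (n : nat) (phi : 'rV[R]_n.+1 -> R)
    (x : 'rV[R]_n.+1) : 'M[R]_n.+1 :=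
  \matrix_(i, j) partial i (partial j phi) x.

Definition qform (R : realType) (n : nat) (A : 'M[R]_n) (v : 'rV[R]_n) : R :=
  dotv (v *m A) v.

(* The sup and inf over unit vectors below are attained: they are the maximum
   and the minimum of a quadratic form on the (nonempty, compact) sphere. *)
Definition inflap_plus (R : realType) (n : nat) (phi : 'rV[R]_n.+1 -> R)
    (x : 'rV[R]_n.+1) : R :=
  if grad phi x == 0
  then sup [set qform (hessian phi x) v | v in [set v | enorm v = 1]]
  else (enorm (grad phi x)) ^- 2 * qform (hessian phi x) (grad phi x).

Definition inflap_minus (R : realType) (n : nat) (phi : 'rV[R]_n.+1 -> R)
    (x : 'rV[R]_n.+1) : R :=
  if grad phi x == 0
  then inf [set qform (hessian phi x) v | v in [set v | enorm v = 1]]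
  else (enorm (grad phi x)) ^- 2 * qform (hessian phi x) (grad phi x).

(* Degree at most 2; A need not be symmetric, as only its symmetric part
   matters. *)
Definition quadratic_poly (R : realType) (n : nat) (phi : 'rV[R]_n.+1 -> R) :
    Prop :=
  exists (c : R) (b : 'rV[R]_n.+1) (A : 'M[R]_n.+1),
    phi = fun x => c + dotv b x + qform A x.

Definition strict_local_max (R : realType) (T : topologicalType) (f : T -> R)
    (x0 : T) : Prop :=
  \forall y \near x0^', f y < f x0.

Definition strict_local_min (R : realType) (T : topologicalType) (f : T -> R)
    (x0 : T) : Prop :=
  \forall y \near x0^', f x0 < f y.

Definition viscosity_solution (R : realType) (n : nat)
    (Omega : set 'rV[R]_n.+1) (gamma : R) (u : 'rV[R]_n.+1 -> R) : Prop :=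
  forall (phi : 'rV[R]_n.+1 -> R) (x0 : 'rV[R]_n.+1),
    quadratic_poly phi -> Omega x0 ->
    (strict_local_max (u \- phi) x0 -> - inflap_plus phi x0 <= gamma) /\
    (strict_local_min (u \- phi) x0 -> gamma <= - inflap_minus phi x0).

(* Functions on the closure of Omega are represented by functions on the whole
   space; their values off the closure play no role. *)
Definition dirichlet_solution (R : realType) (n : nat)
    (Omega : set 'rV[R]_n.+1) (g : 'rV[R]_n.+1 -> R) (gamma : R)
    (u : 'rV[R]_n.+1 -> R) : Prop :=
  [/\ {within closure Omega, continuous u},
      viscosity_solution Omega gamma u
    & forall x, boundary Omega x -> u x = g x].

(* Main.v *)
Require Import Defs.
From mathcomp Require Import all_boot all_order all_algebra.
From mathcomp Require Import all_classical all_reals all_analysis.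
From mathcomp Require Import ring lra.

Set Implicit Arguments.
Unset Strict Implicit.
Unset Printing Implicit Defensive.

Import Order.TTheory GRing.Theory Num.Theory.
Import numFieldNormedType.Exports.

Local Open Scope classical_set_scope.
Local Open Scope ring_scope.

(** Solutions become quantitatively comparable once their slope is bounded
    below.  If v is infinity harmonic with |Dv| >= sigma and h is increasing
    and concave with h'' = - kappa, then formally
    - Delta_oo h(v) = kappa |Dv|^2 >= kappa sigma^2, so that h(v) is a strict
    supersolution of the equation of u_gamma as soon as
    kappa > gamma / sigma^2.  Comparing u_gamma with h(v) costs only the
    distance from h to the identity, of order kappa |v|^2.  Where the slope of
    u_0 is smaller than sigma, u_0 is first raised to the cheapest value
    obtained by leaving the flat region and paying sigma per unit of length;
    this changes it by O(sigma diam).  The total error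
    O(sigma diam + gamma |g|^2 / sigma^2) is balanced by
    sigma = gamma^(1/3) (1 + |g|).

    The argument is made rigorous at a scale e > 0, on the maxima of u and the
    minima of v over Euclidean balls of radius e.  Comparison with parabolic
    cones turns the viscosity inequality into the finite difference inequality
    max + min - 2 u >= - gamma e^2 over such balls
    ([ball_sup_finite_difference]).  Raising the flat region ([steepening]) and
    comparing ([discrete_comparison]) are then elementary facts about functions
    on a set with a symmetric neighbour relation, which need neither continuity
    nor attained extrema.  As e tends to 0 the boundary layer contributes
    nothing, because u and v agree on the boundary and are uniformly continuous
    ([comparison_estimate]).  The path diameter enters only through the number
    of steps of length e that lead out of Omega ([path_diam_chain]).  The two
    inequalities of the theorem come from the pairs (u_gamma, u_0) and
    (- u_gamma, - u_0). *)

(** * Steepening and comparison for a neighbour relation *)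

(** [N x] plays the role of a closed ball of fixed radius about x, [Y] that of
    the points whose ball stays in the domain of the functions, and [I] that of
    the points all of whose neighbours are in [Y]. *)
Section Discrete.
Context (R : realType) (T : Type) (N : T -> set T) (Y I : set T).
Hypothesis Nsym : forall x y, N x y -> N y x.
Hypothesis IY : forall x, I x -> Y x.
Hypothesis NY : forall x y, I x -> N x y -> Y y.

Fixpoint chain (k : nat) (x y : T) : Prop :=
  if k is k'.+1 then exists2 z, N x z & chain k' z y else x = y.

Inductive first_exit (W : set T) : T -> T -> nat -> Prop :=
| exit_now x : ~ W x -> first_exit W x x 0
| exit_step x z y k :
    W x -> N x z -> first_exit W z y k -> first_exit W x y k.+1.

Lemma chain_first_exit (W : set T) k x y : W `<=` I -> chain k x y -> ~ I y ->
  exists2 j, (j <= k)%N & exists z, first_exit W x z j.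
Proof.
move=> WI; elim: k x => [|k IH] x /=.
  move=> -> nIy; exists 0%N => //; exists y; apply: exit_now => /WI; exact.
move=> [z Nxz czy] nIy; have [Wx|nWx] := pselect (W x); last first.
  by exists 0%N => //; exists x; exact: exit_now.
have [j jk [t zt]] := IH _ czy nIy.
by exists j.+1 => //; exists t; exact: exit_step zt.
Qed.

(** The set W of the proof is the flat region, and F the cheapest exit value
    from it when each step costs s.  Following minimizers of V from a point
    outside W never enters W, because the supersolution inequality makes the
    downward slope nondecreasing along that path; this is why F keeps the
    supersolution property across the border of W.  The slack eta is there
    because the infimum defining F need not be attained. *)
Lemma steepening (V : T -> R) (s A : R) (K : nat) :
    0 <= s ->
    (forall x, Y x -> A <= V x) ->
    (forall x, I x -> exists2 z, N x z &
       forall y, N x y -> V z <= V y /\ V z + V y <= 2 * V x) ->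
    (forall x, Y x -> exists2 k, (k <= K)%N &
       exists2 y, chain k x y & ~ I y) ->
  exists F : T -> R,
    [/\ forall x, Y x -> V x <= F x <= V x + 2 * s * K%:R,
        forall x, ~ I x -> F x = V x
      & forall x, I x -> forall eta, 0 < eta ->
          exists2 z, N x z &
            F z <= F x - s + eta /\
            forall y, N x y -> F z + F y <= 2 * F x + eta].
Proof.
move=> s0 AV super exits.
pose W : set T := [set x | I x /\ forall y, N x y -> V x - V y < s].
have WI : W `<=` I by move=> x [].
pose S x := [set r | exists y k, first_exit W x y k /\ r = V y + s * k%:R].
pose F x := inf (S x).
have SnW x : ~ W x -> S x = [set V x].
  move=> nWx; apply/seteqP; split=> r /=.
    move=> [y [k [e ->]]]; case: e nWx => [z _ _|z ? ? ? Wz _ _ /(_ Wz)//].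
    by rewrite mulr0 addr0.
  by move=> ->; exists x, 0%N; split; [exact: exit_now|rewrite mulr0 addr0].
have FnW x : ~ W x -> F x = V x by move=> /SnW; rewrite /F => ->; rewrite inf1.
have up x y k : first_exit W x y k -> V x <= V y + s * k%:R.
  elim=> [z _|{}x z {}y {}k [_ Wx] Nxz _ IH]; first by rewrite mulr0 addr0.
  by have := Wx _ Nxz; rewrite -natr1 mulrDr mulr1; lra.
have dn x y k : first_exit W x y k -> V y <= V x + s * k%:R.
  elim=> [z _|{}x z {}y {}k [Ix Wx] Nxz _ IH]; first by rewrite mulr0 addr0.
  have [t Nxt /(_ _ Nxz)[_ tz]] := super _ Ix.
  by have := Wx _ Nxt; rewrite -natr1 mulrDr mulr1; lra.
have S0 x : Y x -> S x !=set0.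
  move=> Yx; have [k _ [y c nIy]] := exits _ Yx.
  have [j _ [z e]] := chain_first_exit WI c nIy.
  by exists (V z + s * j%:R), z, j.
have Slb x : lbound (S x) (V x) by move=> _ [y [k [/up + ->]]].
have Shlb x : has_lbound (S x) by exists (V x); exact: Slb.
have FW x z : W x -> N x z -> F x <= s + F z.
  move=> Wx Nxz; have Yz := NY (WI _ Wx) Nxz.
  rewrite -lerBlDl; apply: lb_le_inf; first exact: S0.
  move=> _ [y [k [e ->]]]; rewrite lerBlDl; apply: ge_inf => //.
  exists y, k.+1; split; first exact: exit_step e.
  by rewrite -natr1; ring.
exists F; split.
- move=> x Yx; apply/andP; split; first by apply: lb_le_inf; [exact: S0|exact: Slb].
  have [k kK [y c nIy]] := exits _ Yx.
  have [j jk [z e]] := chain_first_exit WI c nIy.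
  have -> : V x + 2 * s * K%:R = V x + s * K%:R + s * K%:R by ring.
  have jK : s * j%:R <= s * K%:R by rewrite ler_wpM2l// ler_nat (leq_trans jk).
  apply: (@le_trans _ _ (V z + s * j%:R)).
    by apply: ge_inf => //; exists z, j.
  by have := dn _ _ _ e; lra.
- by move=> x nIx; apply: FnW => /WI.
- move=> x Ix eta eta0; have [t Nxt tP] := super _ Ix.
  have [Wx|nWx] := pselect (W x).
    (* Inside W a near-optimal exit chain starts with a step that lowers F by
       s up to eta, and no neighbour can exceed F x by more than s. *)
    have hinf : has_inf (S x) by split; [exact/S0/IY|].
    have [_ [y [k [e ->]]] near_inf] := inf_adherent eta0 hinf.
    have : exists2 z, N x z & exists2 j, first_exit W z y j & k = j.+1.
      move: Wx; case: e => [w nW /nW//|w z w' j _ Nwz e _].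
      by exists z => //; exists j.
    move=> [z Nxz [j ezy kj]]; subst k.
    exists z => //.
    have Fz : F z <= F x - s + eta.
      apply: (@le_trans _ _ (V y + s * j%:R)).
        by apply: ge_inf => //; exists y, j.
      by move: near_inf; rewrite -/(F x) -natr1 mulrDr mulr1; lra.
    split=> // w Nxw.
    suff : F w <= s + F x by move: Fz; lra.
    have [Ww|nWw] := pselect (W w); first exact/FW/Nsym.
    rewrite (FnW _ nWw).
    have [r Nxr rP] := super _ (WI _ Wx); have [_ ?] := rP _ Nxw.
    have := Wx.2 _ Nxr; have := up _ _ _ (exit_step Wx Nxz ezy).
    have : V x <= F x.
      apply: lb_le_inf; [exact/S0/IY/(WI _ Wx)|exact: Slb].
    lra.
  (* Outside W the minimizer t of V is itself outside W, so F coincides with V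
     at both x and t. *)
  have Vxt : s <= V x - V t.
    rewrite leNgt; apply/negP => lt; apply: nWx; split => // y Nxy.
    by apply: le_lt_trans lt; have [? _] := tP _ Nxy; lra.
  have nWt : ~ W t.
    move=> [It Wt]; have [r Ntr /(_ _ (Nsym Nxt))[_ rx]] := super _ It.
    by have := Wt _ Ntr; lra.
  exists t => //; rewrite (FnW _ nWt) (FnW _ nWx); split; first by lra.
  move=> y Nxy; have [Wy|nWy] := pselect (W y).
    by have := FW _ _ Wy (Nsym Nxy); rewrite (FnW _ nWx); lra.
  by rewrite (FnW _ nWy); have [_ ?] := tP _ Nxy; lra.
Qed.

(** With h(t) = t + kappa (B t - t^2 / 2), increasing on [-B, B], the second
    difference of h(F) at a point where F descends with slope s is at most
    about - kappa s^2 / 2, whereas at a near-maximum of U - h(F) in [I] it is at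
    least about the second difference - delta of U.  The oscillation of
    h(t) - t on [-B, B] is 2 kappa B^2. *)
Lemma discrete_comparison (U F : T -> R) (s kappa B m delta : R) :
    0 <= kappa -> delta < kappa * s ^+ 2 / 2 -> 0 <= s ->
    (exists b, forall x, Y x -> U x <= b) ->
    (forall x, Y x -> `|F x| <= B) ->
    (forall x, I x -> exists2 z, N x z &
       forall y, N x y -> 2 * U x - delta <= U z + U y) ->
    (forall x, I x -> forall eta, 0 < eta ->
          exists2 z, N x z &
            F z <= F x - s + eta /\
            forall y, N x y -> F z + F y <= 2 * F x + eta) ->
    (forall x, Y x -> ~ I x -> U x <= F x + m) ->
  forall x, Y x -> U x <= F x + 2 * kappa * B ^+ 2 + m.
Proof.
move=> k0 dks s0 [b Ub] FB sub steep bd x0 Yx0.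
pose h t := t + kappa * (B * t - t ^+ 2 / 2).
pose S := [set U x - h (F x) | x in Y].
have hb x : Y x -> - (3 / 2 * kappa * B ^+ 2) <= h (F x) - F x <= kappa * B ^+ 2 / 2.
  move=> /FB; rewrite ler_norml => /andP[Fl Fu]; rewrite /h.
  have : 0 <= kappa * (B - F x) ^+ 2 by rewrite mulr_ge0// sqr_ge0.
  have : 0 <= kappa * ((B + F x) * (3 * B - F x)) by rewrite !mulr_ge0//; lra.
  by move=> ? ?; apply/andP; split; lra.
have S0 : S !=set0 by exists (U x0 - h (F x0)), x0.
have hS : has_sup S.
  split=> //; exists (b + B + 3 / 2 * kappa * B ^+ 2) => _ [x Yx <-].
  have /andP[? _] := hb _ Yx; have := Ub _ Yx.
  by have := FB _ Yx; rewrite ler_norml => /andP[? ?]; lra.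
have USup x : Y x -> U x - h (F x) <= sup S.
  by move=> Yx; apply: ub_le_sup; [exact: hS.2|exists x].
suff supS : sup S <= m + 3 / 2 * kappa * B ^+ 2.
  by have := USup _ Yx0; have /andP[_ ?] := hb _ Yx0; lra.
rewrite leNgt; apply/negP => lt_sup.
pose gap := kappa * s ^+ 2 / 2 - delta.
(* 4 C bounds the total factor of eta below: the slack of the near-maximum,
   the slack of F times h', and the loss from s to s - eta. *)
pose C := 1 + kappa * (2 * B + s).
have B0 : 0 <= B by apply: le_trans (FB _ Yx0).
have C1 : 1 <= C by rewrite lerDl mulr_ge0// addr_ge0// mulr_ge0.
pose eta := Num.min (gap / (4 * C)) (sup S - (m + 3 / 2 * kappa * B ^+ 2)).
have eta0 : 0 < eta.
  by rewrite lt_min subr_gt0 lt_sup andbT divr_gt0 ?subr_gt0// mulr_gt0//; lra.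
have etaC : 4 * C * eta <= gap.
  rewrite -ler_pdivlMl; last by rewrite mulr_gt0//; lra.
  by rewrite mulrC ge_min lexx.
have eta_sup : eta <= sup S - (m + 3 / 2 * kappa * B ^+ 2).
  by rewrite ge_min lexx orbT.
have [_ [x Yx <-] xsup] := sup_adherent eta0 hS.
have Ix : I x.
  apply: contrapT => nIx; have := bd _ Yx nIx.
  by have /andP[? _] := hb _ Yx; lra.
have [zU NzU subx] := sub _ Ix.
have [z Nz [Fz steepx]] := steep _ Ix _ eta0.
have := subx _ Nz; have := steepx _ NzU.
have := USup _ (NY Ix Nz); have := USup _ (NY Ix NzU).
have := FB _ Yx; rewrite ler_norml.
have := FB _ (NY Ix Nz); rewrite ler_norml.
have := FB _ (NY Ix NzU); rewrite ler_norml.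
move: Fz xsup; rewrite /h.
set t := F x; set p := F z; set q := F zU; set M := sup S.
move=> Fz xsup /andP[ql qu] /andP[pl pu] /andP[tl tu] Mq Mp pq UU.
have C0 : 0 <= kappa * ((t - p) - s) ^+ 2 by rewrite mulr_ge0// sqr_ge0.
have C2 : 0 <= kappa * (q - t) ^+ 2 by rewrite mulr_ge0// sqr_ge0.
have C3 : 0 <= kappa * s * (t - p - (s - eta)) by rewrite !mulr_ge0//; lra.
have C4 : 0 <= kappa * (B - t) * (eta - (q + p - 2 * t)).
  by rewrite !mulr_ge0//; lra.
have C5 : 0 <= kappa * (B + t) * eta by rewrite !mulr_ge0//; lra.
have C6 : 0 <= kappa * B * eta by rewrite !mulr_ge0//; lra.
have C7 : 0 <= kappa * s * eta by rewrite !mulr_ge0//; lra.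
have : 2 * (M - eta) - delta < 2 * M + (h q - h t + (h p - h t)).
  by rewrite /h; lra.
have -> : h q - h t + (h p - h t) =
    (1 + kappa * (B - t)) * (q + p - 2 * t)
    - kappa / 2 * ((q - t) ^+ 2 + (t - p) ^+ 2) by rewrite /h; field.
move: etaC; rewrite /gap /C; lra.
Qed.
End Discrete.

(** * The Euclidean norm of row vectors *)

Section EuclideanNorm.
Context (R : realType) (n : nat).
Implicit Types x y z : 'rV[R]_n.

Lemma dotvC x y : dotv x y = dotv y x.
Proof. by apply: eq_bigr => i _; rewrite mulrC. Qed.

Lemma dotvDl x y z : dotv (x + y) z = dotv x z + dotv y z.
Proof. by rewrite -big_split; apply: eq_bigr => i _; rewrite mxE mulrDl. Qed.

Lemma dotvZl a x y : dotv (a *: x) y = a * dotv x y.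
Proof. by rewrite mulr_sumr; apply: eq_bigr => i _; rewrite mxE mulrA. Qed.

Lemma dotvNl x y : dotv (- x) y = - dotv x y.
Proof. by rewrite -scaleN1r dotvZl mulN1r. Qed.

Lemma dotvDr x y z : dotv x (y + z) = dotv x y + dotv x z.
Proof. by rewrite dotvC dotvDl !(dotvC x). Qed.

Lemma dotvZr a x y : dotv x (a *: y) = a * dotv x y.
Proof. by rewrite dotvC dotvZl dotvC. Qed.

Lemma dotvNr x y : dotv x (- y) = - dotv x y.
Proof. by rewrite dotvC dotvNl dotvC. Qed.

Lemma dotv0 x : dotv x 0 = 0.
Proof. by rewrite -(scale0r 0) dotvZr mul0r. Qed.

Definition dotvE := (dotvDl, dotvDr, dotvNl, dotvNr, dotvZl, dotvZr).

Lemma dotv_ge0 x : 0 <= dotv x x.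
Proof. by apply: sumr_ge0 => i _; rewrite -expr2 sqr_ge0. Qed.

Lemma dotv_eq0 x : dotv x x = 0 -> x = 0.
Proof.
move=> /eqP; rewrite psumr_eq0 => [/allP x0|i _]; last by rewrite -expr2 sqr_ge0.
apply/rowP => i; rewrite mxE; have := x0 i (mem_index_enum _).
by rewrite -expr2 sqrf_eq0 => /eqP.
Qed.

Lemma enorm_ge0 x : 0 <= enorm x. Proof. exact: sqrtr_ge0. Qed.

Lemma sqr_enorm x : enorm x ^+ 2 = dotv x x.
Proof. by rewrite sqr_sqrtr// dotv_ge0. Qed.

Lemma enorm0 : enorm (0 : 'rV[R]_n) = 0.
Proof. by rewrite /enorm dotv0 sqrtr0. Qed.

Lemma enorm_eq0 x : enorm x = 0 -> x = 0.
Proof. by move=> x0; apply: dotv_eq0; rewrite -sqr_enorm x0 expr0n. Qed.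

Lemma enormZ a x : enorm (a *: x) = `|a| * enorm x.
Proof.
by rewrite /enorm dotvZl dotvZr mulrA sqrtrM -?expr2 ?sqr_ge0// sqrtr_sqr.
Qed.

Lemma enormN x : enorm (- x) = enorm x.
Proof. by rewrite -scaleN1r enormZ normrN1 mul1r. Qed.

Lemma enorm_distC x y : enorm (x - y) = enorm (y - x).
Proof. by rewrite -enormN opprB. Qed.

Lemma cauchy_schwarz x y : dotv x y <= enorm x * enorm y.
Proof.
have [y0|y0] := eqVneq y 0.
  by rewrite y0 enorm0 mulr0 dotv0.
have yy : 0 < dotv y y.
  by rewrite lt_neqAle dotv_ge0 andbT eq_sym; apply: contra_neq y0; exact: dotv_eq0.
apply: le_trans (ler_norm _) _.
rewrite -ler_sqr ?nnegrE ?normr_ge0 ?mulr_ge0 ?enorm_ge0//.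
rewrite real_normK ?num_real// exprMn !sqr_enorm.
have := dotv_ge0 (dotv y y *: x - dotv x y *: y).
rewrite !dotvE (dotvC y x) => h.
rewrite -subr_ge0 -(pmulr_rge0 _ yy).
by apply: le_trans h _; rewrite le_eqVlt; apply/orP; left; apply/eqP; ring.
Qed.

Lemma sqr_enormD x y :
  enorm (x + y) ^+ 2 = enorm x ^+ 2 + 2 * dotv x y + dotv y y.
Proof. by rewrite !sqr_enorm !dotvE (dotvC y x); ring. Qed.

Lemma ler_enormD x y : enorm (x + y) <= enorm x + enorm y.
Proof.
rewrite -ler_sqr ?nnegrE ?addr_ge0 ?enorm_ge0//.
rewrite sqr_enormD -sqr_enorm sqrrD.
by have := cauchy_schwarz x y; lra.
Qed.

Lemma ler_enorm_dist z x y : enorm (x - y) <= enorm (x - z) + enorm (z - y).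
Proof. by rewrite -(subrKA z x) ler_enormD. Qed.

Lemma coord_le_norm x i : `|x 0 i| <= `|x|.
Proof.
by rewrite [leRHS]/Num.norm /= mx_normrE; apply/bigmax_geP; right; exists (0, i).
Qed.

Lemma norm_le_enorm x : `|x| <= enorm x.
Proof.
rewrite [leLHS]/Num.norm /= mx_normrE; apply/bigmax_leP; split=> [|[j i] _ /=].
  exact: enorm_ge0.
rewrite (ord1 j) -sqrtr_sqr ler_wsqrtr// /dotv (bigD1 i)//= -expr2 lerDl.
by apply: sumr_ge0 => k _; rewrite -expr2 sqr_ge0.
Qed.

Lemma enorm_le_norm x : enorm x <= n%:R * `|x|.
Proof.
rewrite -ler_sqr ?nnegrE ?enorm_ge0 ?mulr_ge0// sqr_enorm.
apply: (@le_trans _ _ (\sum_(i < n) `|x| ^+ 2)).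
  apply: ler_sum => i _; rewrite -expr2 -(real_normK (num_real _)).
  by rewrite ler_sqr ?nnegrE// coord_le_norm.
rewrite sumr_const card_ord -[leLHS]mulr_natl exprMn ler_wpM2r ?sqr_ge0//.
by rewrite expr2 -natrM ler_nat; case: (n) => // k; rewrite leq_pmull.
Qed.

End EuclideanNorm.

Section EuclideanTopology.
Context (R : realType) (n : nat).
Implicit Types x y z : 'rV[R]_n.+1.

Lemma near_enorm x (e : R) : 0 < e -> \forall y \near x, enorm (y - x) < e.
Proof.
move=> e0; have n0 : 0 < n.+1%:R :> R by rewrite ltr0n.
have d0 : 0 < e / n.+1%:R by rewrite divr_gt0.
near=> y; apply: le_lt_trans (enorm_le_norm _) _.
rewrite mulrC -ltr_pdivlMr// distrC; near: y.
Unshelve. all: by end_near. Qed.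

Lemma nbhs_enorm x (A : set 'rV[R]_n.+1) : nbhs x A ->
  exists2 e : R, 0 < e & forall y, enorm (y - x) <= e -> A y.
Proof.
move=> /nbhs_ballP[e /= e0 xA]; exists (e / 2); first by rewrite divr_gt0.
move=> y yx; apply: xA; rewrite mx_norm_ball /ball_ /= distrC.
by apply: le_lt_trans (norm_le_enorm _) _; apply: le_lt_trans yx _; lra.
Qed.

Lemma enorm_dist_continuous x : continuous (fun y : 'rV[R]_n.+1 => enorm (y - x)).
Proof.
move=> z; apply/(@cvgrPdist_le _ _ _ (nbhs z)) => e e0; near=> y.
have zy : enorm (y - z) < e by near: y; exact: near_enorm.
rewrite ler_norml; apply/andP; split.
  by have := ler_enorm_dist z y x; lra.
by have := ler_enorm_dist y z x; rewrite (enorm_distC z y); lra.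
Unshelve. all: by end_near. Qed.

Lemma dotv_continuous b : continuous (dotv b : 'rV[R]_n.+1 -> R).
Proof.
move=> x; apply/(@cvgrPdist_le _ _ _ (nbhs x)) => e e0.
have b1 : 0 < enorm b + 1 by rewrite ltr_wpDl ?enorm_ge0.
near=> y.
have xy : enorm (y - x) < e / (enorm b + 1).
  by near: y; apply: near_enorm; rewrite divr_gt0.
rewrite -dotvNr -dotvDr; apply: (@le_trans _ _ (enorm b * enorm (y - x))).
  rewrite ler_norml; apply/andP; split; last by rewrite enorm_distC cauchy_schwarz.
  by rewrite lerNl -dotvNr opprB cauchy_schwarz.
apply: (@le_trans _ _ ((enorm b + 1) * enorm (y - x))).
  by rewrite ler_wpM2r ?enorm_ge0// lerDl.
by rewrite mulrC -ler_pdivlMr// ltW.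
Unshelve. all: by end_near. Qed.

Definition eball x (r : R) : set 'rV[R]_n.+1 := [set y | enorm (y - x) <= r].

Lemma compact_eball x r : compact (eball x r).
Proof.
apply: bounded_closed_compact.
  exists (`|x| + r); split; first exact: num_real.
  move=> M ltM y /= yr; apply: le_trans (ltW ltM).
  rewrite -(subrK x y) addrC; apply: le_trans (ler_normD _ _) _.
  by rewrite lerD2l (le_trans (norm_le_enorm _)).
have -> : eball x r = (fun y => enorm (y - x)) @^-1` [set t | t <= r] by [].
apply: preimage_closed => [y _|]; [exact: enorm_dist_continuous|exact: closed_le].
Qed.

End EuclideanTopology.

(** * Viscosity inequalities tested on rank-one paraboloids *)

Section TestParaboloids.
Context (R : realType) (n : nat).
Implicit Types (x p : 'rV[R]_n.+1) (a b c : R).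

(** Among quadratic polynomials, those whose Hessian is a multiple of the
    identity plus a multiple of p p^T, with p the gradient at x0, are enough for
    touching cones and for the maximum principle. *)
Definition paraboloid x0 c p a b (y : 'rV[R]_n.+1) : R :=
  c + dotv p (y - x0) + a * dotv (y - x0) (y - x0) + b * dotv p (y - x0) ^+ 2.

Definition outer_mx a b p : 'M[R]_n.+1 := a%:M + b *: (p^T *m p).

Lemma qform_outer_mx a b p y :
  qform (outer_mx a b p) y = a * dotv y y + b * dotv p y ^+ 2.
Proof.
rewrite /qform /outer_mx mulmxDr mul_mx_scalar -scalemxAr mulmxA.
have -> : y *m p^T = (dotv p y)%:M.
  apply/matrixP => i j; rewrite !ord1 !mxE mulr1n.
  by apply: eq_bigr => k _; rewrite !mxE mulrC.
by rewrite mul_scalar_mx !dotvE; ring.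
Qed.

Lemma quadratic_paraboloid x0 c p a b : quadratic_poly (paraboloid x0 c p a b).
Proof.
exists (c - dotv p x0 + a * dotv x0 x0 + b * dotv p x0 ^+ 2),
  (p - (2 * a) *: x0 - (2 * b * dotv p x0) *: p), (outer_mx a b p).
apply/funext => y; rewrite qform_outer_mx /paraboloid !dotvE (dotvC y x0).
ring.
Qed.

Lemma derive_quadratic (f : 'rV[R]_n.+1 -> R) v x (l q : R) :
  (forall h : R, f (h *: v + x) - f x = h * (l + h * q)) -> 'D_v f x = l.
Proof.
move=> fE; rewrite /derive; apply: cvg_lim; first exact: Rhausdorff.
have lq : (fun h : R => l + h * q) @ 0^' --> l.
  rewrite -[X in _ --> X]addr0 -[X in _ --> _ + X](mul0r q).
  apply: cvg_within_filter; apply: cvgD; first exact: cvg_cst.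
  by apply: cvgM; [exact: cvg_id|exact: cvg_cst].
apply: cvg_trans lq; apply: near_eq_cvg; near=> h.
have h0 : h != 0 by near: h; exact: nbhs_dnbhs_neq.
by rewrite /= fE /GRing.scale /= mulKf.
Unshelve. all: by end_near. Qed.

Lemma dotv_delta p i : dotv p (delta_mx 0 i) = p 0 i.
Proof.
rewrite /dotv (bigD1 i)//= mxE !eqxx mulr1 big1 ?addr0// => j ji.
by rewrite mxE (negbTE ji) andbF mulr0.
Qed.

Lemma partial_paraboloid i x0 c p a b x :
  partial i (paraboloid x0 c p a b) x =
  p 0 i + 2 * a * (x - x0) 0 i + 2 * b * dotv p (x - x0) * p 0 i.
Proof.
apply: (@derive_quadratic _ _ _ _ (a + b * p 0 i ^+ 2)) => h.
rewrite /paraboloid -[h *: _ + x - x0]addrA; move: (x - x0) => w.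
rewrite !dotvE (dotvC (delta_mx 0 i) w) !dotv_delta !mxE !eqxx /=.
ring.
Qed.

Lemma grad_paraboloid x0 c p a b : grad (paraboloid x0 c p a b) x0 = p.
Proof.
apply/rowP => i; rewrite mxE partial_paraboloid subrr mxE.
by rewrite dotv0; ring.
Qed.

Lemma hessian_paraboloid x0 c p a b :
  hessian (paraboloid x0 c p a b) x0 = outer_mx (2 * a) (2 * b) p.
Proof.
apply/matrixP => i j; rewrite !mxE big_ord1 !mxE.
have -> : partial j (paraboloid x0 c p a b) =
    fun x => p 0 j + 2 * a * (x - x0) 0 j + 2 * b * dotv p (x - x0) * p 0 j.
  by apply/funext => x; rewrite partial_paraboloid.
apply: (@derive_quadratic _ _ _ _ 0) => h; rewrite addrK subrr.
rewrite !dotvE dotv_delta !mxE !eqxx dotv0 eq_sym /=.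
by case: eqP => _; rewrite /=; ring.
Qed.

Lemma inflap_paraboloid x0 c p a b : p != 0 ->
  inflap_plus (paraboloid x0 c p a b) x0 = 2 * (a + b * dotv p p) /\
  inflap_minus (paraboloid x0 c p a b) x0 = 2 * (a + b * dotv p p).
Proof.
move=> p0; rewrite /inflap_plus /inflap_minus grad_paraboloid (negbTE p0).
rewrite hessian_paraboloid qform_outer_mx sqr_enorm.
suff pp : dotv p p != 0 by split; field.
by apply: contra_neq p0 => /dotv_eq0.
Qed.

(** Touching is not required to be strict, and the gradient p is nonzero, so
    that both infinity Laplacians of the test function equal
    2 (a + b |p|^2).  Supersolutions are treated as subsolutions of the opposite
    function. *)
Definition subsolution (Omega : set 'rV[R]_n.+1) gamma (u : 'rV[R]_n.+1 -> R) :=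
  forall x0 p a b, Omega x0 -> p != 0 ->
    (\forall y \near x0, u y <= paraboloid x0 (u x0) p a b y) ->
    - 2 * (a + b * dotv p p) <= gamma.

Lemma paraboloid_center x0 c p a b : paraboloid x0 c p a b x0 = c.
Proof. by rewrite /paraboloid subrr !dotv0; ring. Qed.

Lemma paraboloid_lt x0 c p a b d y : 0 < d -> y != x0 ->
  paraboloid x0 c p a b y < paraboloid x0 c p (a + d) b y.
Proof.
move=> d0 yx; rewrite -subr_gt0 /paraboloid.
have : 0 < d * dotv (y - x0) (y - x0).
  rewrite mulr_gt0// lt_neqAle dotv_ge0 andbT eq_sym.
  by apply: contra_neq yx => /dotv_eq0/subr0_eq.
lra.
Qed.

(** Adding e/2 |y - x0|^2 to the test function makes the contact strict and
    changes its infinity Laplacian by e. *)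
Lemma viscosity_subsolution Omega gamma u :
  viscosity_solution Omega gamma u -> subsolution Omega gamma u.
Proof.
move=> visc x0 p a b Ox0 p0 up; apply/ler_addgt0Pr => e e0.
have := (visc _ _ (quadratic_paraboloid x0 0 p (a + e / 2) b) Ox0).1.
rewrite (inflap_paraboloid _ _ _ _ p0).1 => H.
suff /H : strict_local_max (u \- paraboloid x0 0 p (a + e / 2) b) x0 by lra.
near=> y; rewrite /= paraboloid_center subr0.
have yx : y != x0 by near: y; exact: nbhs_dnbhs_neq.
have uy : u y <= paraboloid x0 (u x0) p a b y.
  by near: y; exact: cvg_within up.
have e20 : 0 < e / 2 by rewrite divr_gt0.
have := paraboloid_lt (u x0) p a b e20 yx.
by move: uy; rewrite /paraboloid; lra.
Unshelve. all: by end_near. Qed.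

Lemma viscosity_supersolution Omega gamma u :
  viscosity_solution Omega gamma u -> subsolution Omega (- gamma) (\- u).
Proof.
move=> visc x0 p a b Ox0 p0 up; apply/ler_addgt0Pr => e e0.
have := (visc _ _ (quadratic_paraboloid x0 0 (- p) (- (a + e / 2)) (- b)) Ox0).2.
have Np0 : - p != 0 by rewrite oppr_eq0.
rewrite (inflap_paraboloid _ _ _ _ Np0).2 !dotvE => H.
suff /H : strict_local_min (u \- paraboloid x0 0 (- p) (- (a + e / 2)) (- b)) x0.
  by lra.
near=> y; rewrite /= paraboloid_center subr0.
have yx : y != x0 by near: y; exact: nbhs_dnbhs_neq.
have uy : - u y <= paraboloid x0 (- u x0) p a b y.
  by near: y; exact: cvg_within up.
have e20 : 0 < e / 2 by rewrite divr_gt0.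
have := paraboloid_lt (- u x0) p a b e20 yx.
by move: uy; rewrite /paraboloid !dotvE; lra.
Unshelve. all: by end_near. Qed.

Lemma subsolution_le Omega gamma gamma' u :
  gamma <= gamma' -> subsolution Omega gamma u -> subsolution Omega gamma' u.
Proof. by move=> gg sub x0 p a b Ox p0 /(sub _ _ _ _ Ox p0)/le_trans; apply. Qed.

End TestParaboloids.

(** * Comparison with parabolic cones and finite differences *)

Section ConeComparison.
Context (R : realType) (n : nat).
Implicit Types (x p : 'rV[R]_n.+1) (a b c e r gamma : R).

(** A quadratic polynomial that touches the norm from above at w and whose
    second derivative in the radial direction w is 0, as for the norm itself;
    this is exact where it matters for the infinity Laplacian.  The tangential
    coefficient is doubled to absorb the variation of the radius. *)
Lemma enorm_tangent_le (w h : 'rV[R]_n.+1) : 0 < enorm w ->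
    - (enorm w / 2) <= dotv w h / enorm w ->
  enorm (w + h) <= enorm w + dotv w h / enorm w
    + (dotv h h - (dotv w h / enorm w) ^+ 2) / enorm w.
Proof.
set r := enorm w; set t := dotv w h / r => r0 tr.
have wh : dotv w h = t * r by rewrite /t divfK// gt_eqF.
have k0 : 0 <= dotv h h - t ^+ 2.
  have := dotv_ge0 (h - (t / r) *: w).
  rewrite !dotvE (dotvC h w) wh -(sqr_enorm w) -/r.
  move/le_trans; apply; rewrite le_eqVlt; apply/orP; left; apply/eqP.
  by field; rewrite gt_eqF.
have kr0 : 0 <= (dotv h h - t ^+ 2) / r by rewrite divr_ge0// ltW.
rewrite -ler_sqr ?nnegrE ?enorm_ge0//; last by rewrite addr_ge0//; lra.
rewrite sqr_enormD wh -/r.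
have : 0 <= (2 * t + r) * ((dotv h h - t ^+ 2) / r) by rewrite mulr_ge0//; lra.
have := sqr_ge0 ((dotv h h - t ^+ 2) / r).
have : r * ((dotv h h - t ^+ 2) / r) = dotv h h - t ^+ 2.
  by rewrite mulrC divfK// gt_eqF.
move: ((dotv h h - t ^+ 2) / r) => k; lra.
Qed.

(** On the ball of radius 2 e the radial function
    u x + A r - gamma' r^2 / 2 that equals u z at r = 2 e lies above u: at a
    point of largest failure a translate of it would touch u from above, and its
    infinity Laplacian is - gamma' < - gamma.  Contact where it is radially
    nonincreasing is excluded because there it is at least u z, the maximum of
    u.  The inequality bounds u by the value at r = e; this function increases
    up to there. *)
Lemma parabolic_cone_comparison (Omega : set 'rV[R]_n.+1) gamma gamma' u x z e :
    subsolution Omega gamma u -> 0 <= gamma -> gamma < gamma' ->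
    0 < e -> eball x (2 * e) `<=` Omega ->
    {within eball x (2 * e), continuous u} ->
    eball x (2 * e) z -> (forall y, eball x (2 * e) y -> u y <= u z) ->
  forall y, eball x e y -> 2 * u y <= u x + u z + gamma' * e ^+ 2.
Proof.
move=> sub g0 gg' e0 xO uC xz uz.
have g'0 : 0 < gamma' by lra.
have xx : eball x (2 * e) x by rewrite /eball /= subrr enorm0; lra.
pose A := (u z - u x) / (2 * e) + gamma' * e.
have Ae : 2 * e * A = u z - u x + 2 * gamma' * e ^+ 2.
  by rewrite /A; field; rewrite gt_eqF.
have Age : gamma' * e <= A.
  by rewrite lerDr divr_ge0// ?subr_ge0 ?uz//; lra.
have A0 : 0 <= A by apply: le_trans Age; rewrite mulr_ge0// ltW.
pose q r := A * r - gamma' / 2 * r ^+ 2.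
have claim y : eball x (2 * e) y -> u y <= u x + q (enorm (y - x)).
  have qC : continuous (fun y : 'rV[R]_n.+1 => q (enorm (y - x))).
    move=> w.
    apply: (@continuous_comp _ _ _ (fun y : 'rV[R]_n.+1 => enorm (y - x)) q).
      exact: enorm_dist_continuous.
    apply: cvgB; (apply: cvgM; first exact: cvg_cst); first exact: cvg_id.
    exact: exprn_continuous.
  have [w0] : exists2 w0, w0 \in eball x (2 * e) &
      forall t, t \in eball x (2 * e) ->
      u t - q (enorm (t - x)) <= u w0 - q (enorm (w0 - x)).
    apply: (@compact_EVT_max _ _ (fun t => u t - q (enorm (t - x)))).
    - by exists x.
    - exact: compact_eball.
    - move=> w; apply: cvgB; first exact: uC.
      exact: (continuous_subspaceT qC).
  rewrite inE => w0B w0max xy.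
  rewrite -lerBlDr; apply: le_trans (w0max _ (mem_set xy)) _.
  rewrite leNgt; apply/negP => ltw0.
  set r0 := enorm (w0 - x) in w0max ltw0.
  have r0e : r0 <= 2 * e := w0B.
  have r0_ge0 : 0 <= r0 := enorm_ge0 _.
  have r0_gt0 : 0 < r0.
    rewrite lt_neqAle r0_ge0 andbT eq_sym; apply/eqP => r00.
    have w0x : w0 = x by apply/subr0_eq/enorm_eq0.
    by move: ltw0; rewrite /q r00 w0x; lra.
  have uw0 := uz _ w0B.
  have bad : 0 <= (2 * e - r0) * (gamma' * (2 * e + r0) / 2 - A) -> False.
    by move: ltw0 Ae; rewrite /q; lra.
  have l0 : 0 < A - gamma' * r0.
    rewrite ltNge; apply/negP => l0; apply: bad; apply: mulr_ge0; first by lra.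
    have : 0 <= gamma' * (2 * e - r0) by rewrite mulr_ge0; lra.
    lra.
  have r0lt : r0 < 2 * e.
    rewrite lt_neqAle r0e andbT; apply/eqP => r0E; apply: bad.
    by rewrite r0E subrr mul0r.
  set l := A - gamma' * r0 in l0.
  (* E is the radial unit vector, kept abstract so that bilinearity does not
     expand it. *)
  have [E E_def] : exists E, E = r0^-1 *: (w0 - x) by exists (r0^-1 *: (w0 - x)).
  have EE : dotv E E = 1.
    by rewrite E_def !dotvZl !dotvZr -sqr_enorm -/r0; field; rewrite gt_eqF.
  (* The term in b cancels the radial part of A / r0 |h|^2, leaving - gamma' as
     the second derivative in the direction E. *)
  have := sub w0 (l *: E) (A / r0 - gamma' / 2) (- (A / (r0 * l ^+ 2))).
  have -> : A / r0 - gamma' / 2 + - (A / (r0 * l ^+ 2)) * dotv (l *: E) (l *: E)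
      = - (gamma' / 2).
    rewrite !dotvZl !dotvZr EE; field.
    by rewrite !gt_eqF.
  move=> /(_ (xO _ w0B)) H.
  suff : -2 * - (gamma' / 2) <= gamma by lra.
  apply: H.
    rewrite scaler_eq0 gt_eqF//=; apply/eqP => E0.
    by move: EE; rewrite E0 dotv0 => /esym/eqP; rewrite oner_eq0.
  have d0 : 0 < 2 * e - r0 by lra.
  have r2 : 0 < r0 / 2 by lra.
  near=> y'.
  have hr : enorm (y' - w0) < r0 / 2 by near: y'; exact: near_enorm.
  have yB : eball x (2 * e) y'.
    have : enorm (y' - w0) < 2 * e - r0 by near: y'; exact: near_enorm.
    by have := ler_enorm_dist w0 y' x; rewrite /eball /= -/r0; lra.
  have := w0max _ (mem_set yB).
  have yE : y' - x = (w0 - x) + (y' - w0) by rewrite [RHS]addrC subrKA.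
  have tE : dotv (w0 - x) (y' - w0) / r0 = dotv E (y' - w0).
    by rewrite E_def dotvZl mulrC.
  have : enorm (y' - x) <= r0 + dotv E (y' - w0) +
      (dotv (y' - w0) (y' - w0) - dotv E (y' - w0) ^+ 2) / r0.
    rewrite yE -tE; apply: enorm_tangent_le => //; rewrite -/r0 tE.
    rewrite lerNl -dotvNl; apply: le_trans (cauchy_schwarz _ _) _.
    by rewrite enormN /enorm EE sqrtr1 mul1r ltW.
  have : enorm (y' - x) ^+ 2 = r0 ^+ 2 + 2 * r0 * dotv E (y' - w0)
      + dotv (y' - w0) (y' - w0).
    rewrite yE sqr_enormD -/r0 -tE.
    by field; rewrite gt_eqF.
  rewrite /paraboloid dotvZl /q.
  move: (enorm (y' - x)) (dotv E _) (dotv (y' - w0) _) => rho t s rho2 rho_le.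
  move: rho_le => /(ler_wpM2l A0) Arho.
  have -> : - (A / (r0 * l ^+ 2)) * (l * t) ^+ 2 = - (A / r0) * t ^+ 2.
    by field; rewrite !gt_eqF.
  move: Arho; rewrite rho2 /l.
  move: r0^-1 => i; lra.
move=> y xy.
have /claim : eball x (2 * e) y by move: xy; rewrite /eball /=; lra.
move: xy; rewrite /eball /=; move: (enorm_ge0 (y - x)).
move: (enorm (y - x)) => r r0 re; rewrite /q.
have : 0 <= (e - r) * (A - gamma' * e) by rewrite mulr_ge0; lra.
have : 0 <= gamma' * (e - r) ^+ 2 by rewrite mulr_ge0 ?sqr_ge0 1?ltW.
lra.
Unshelve. all: by end_near. Qed.

Definition ball_sup u e x : R := sup [set u y | y in eball x e].

Lemma ball_sup_attained u e x : 0 <= e -> {within eball x e, continuous u} ->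
  (exists2 y, eball x e y & ball_sup u e x = u y) /\
  forall y, eball x e y -> u y <= ball_sup u e x.
Proof.
move=> e0 uC.
have xx : eball x e x by rewrite /eball /= subrr enorm0.
have [z] := compact_EVT_max (ex_intro _ _ xx) (@compact_eball _ _ x e) uC.
rewrite inE => xz zmax.
have ub : ubound [set u y | y in eball x e] (u z).
  by move=> _ [y xy <-]; apply: zmax; rewrite inE.
have bsup y : eball x e y -> u y <= ball_sup u e x.
  by move=> xy; apply: ub_le_sup; [exists (u z)|exists y].
split=> //; exists z => //; apply/eqP; rewrite eq_le bsup// andbT.
by apply: ge_sup => //; exists (u x), x.
Qed.

Lemma eball_trans x y z r r' :
  eball x r y -> eball y r' z -> eball x (r + r') z.
Proof. by rewrite /eball /=; have := ler_enorm_dist y z x; lra. Qed.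

Lemma eball_sym x y r : eball x r y -> eball y r x.
Proof. by rewrite /eball /= enorm_distC. Qed.

(** The neighbour z is the midpoint of x and a maximum point of u on the ball
    of radius 2 e, so that [ball_sup u e] takes at z its largest value near x;
    any other neighbour y has x in its own ball, which gives u x as a lower
    bound.  The cone comparison then bounds 2 u. *)
Lemma ball_sup_finite_difference (Omega : set 'rV[R]_n.+1) gamma u e x :
    subsolution Omega gamma u -> 0 <= gamma -> {within Omega, continuous u} ->
    0 < e -> eball x (2 * e) `<=` Omega ->
  exists2 z, eball x e z &
    forall y, eball x e y -> ball_sup u e y <= ball_sup u e z /\
      2 * ball_sup u e x - gamma * e ^+ 2 <= ball_sup u e z + ball_sup u e y.
Proof.
move=> sub g0 uC e0 xO.
have e0' := ltW e0.
have e2 : e + e = 2 * e by ring.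
have bO y : eball x e y -> eball y e `<=` eball x (2 * e).
  by move=> xy t yt; rewrite -e2; exact: eball_trans xy yt.
have bC y : eball x e y -> {within eball y e, continuous u}.
  by move=> xy; apply: continuous_subspaceW uC => t /(bO _ xy)/xO.
have xx : eball x e x by rewrite /eball /= subrr enorm0.
have e20 : 0 <= 2 * e by lra.
have [[z xz zE] zmax] := ball_sup_attained e20 (continuous_subspaceW xO uC).
pose z' := x + 2^-1 *: (z - x).
have xz' : eball x e z'.
  move: xz; rewrite /eball /= /z' addrAC subrr add0r enormZ gtr0_norm; lra.
have zz' : eball z' e z.
  rewrite /eball /= /z'.
  have -> : z - (x + 2^-1 *: (z - x)) = 2^-1 *: (z - x).
    by apply/rowP => i; rewrite !mxE; field.
  move: xz; rewrite /eball /= enormZ gtr0_norm; lra.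
have zU : u z <= ball_sup u e z' by apply: (ball_sup_attained e0' (bC _ xz')).2.
exists z' => // y xy.
have [[t yt tE] ymax] := ball_sup_attained e0' (bC _ xy).
have [[s xs ->] _] := ball_sup_attained e0' (bC _ xx).
have ux : u x <= ball_sup u e y by apply: ymax; exact: eball_sym.
split; first by apply: le_trans zU; rewrite tE -zE zmax//; exact: bO yt.
have : 2 * u s <= u x + u z + gamma * e ^+ 2.
  apply/ler_addgt0Pr => d d0.
  have e2d : 0 < e ^+ 2 by rewrite exprn_gt0.
  have gd : gamma < gamma + d / e ^+ 2 by rewrite ltrDl divr_gt0.
  have xO' := continuous_subspaceW xO uC.
  have uz w : eball x (2 * e) w -> u w <= u z by move=> xw; rewrite -zE zmax.
  have := parabolic_cone_comparison sub g0 gd e0 xO xO' xz uz xs.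
  suff -> : (gamma + d / e ^+ 2) * e ^+ 2 = gamma * e ^+ 2 + d by lra.
  by rewrite mulrDl divfK ?gt_eqF.
lra.
Qed.

End ConeComparison.

(** * Bounded open sets: boundary points and the maximum principle *)

Section Domain.
Context (R : realType) (n : nat) (Omega : set 'rV[R]_n.+1).
Hypotheses (oO : open Omega) (bO : bounded_set Omega).

Lemma closure_nearby x (e : R) : 0 < e -> closure Omega x ->
  exists2 y, Omega y & enorm (y - x) < e.
Proof. by move=> e0 /(_ _ (near_enorm x e0))[y [Oy xy]]; exists y. Qed.

Lemma enorm_closure_bounded :
  exists2 M : R, 0 < M & forall x, closure Omega x -> enorm x <= M.
Proof.
have [M [_ MO]] := bO.
have /MO {}MO : M < `|M| + 1 by rewrite ltr_pwDr// ler_norm.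
exists (n.+1%:R * (`|M| + 1) + 1).
  by rewrite ltr_wpDl// mulr_ge0// addr_ge0.
move=> x /(closure_nearby ltr01)[y Oy yx].
have := ler_enormD y (x - y); rewrite addrC subrK enorm_distC.
have : n.+1%:R * `|y| <= n.+1%:R * (`|M| + 1) by rewrite ler_wpM2l// MO.
by have := enorm_le_norm y; lra.
Qed.

Lemma compact_closure_domain : compact (closure Omega).
Proof.
apply: bounded_closed_compact; last exact: closed_closure.
have [M M0 MO] := enorm_closure_bounded.
exists M; split; first exact: num_real.
by move=> r Mr x /MO xM /=; apply: le_trans (norm_le_enorm _) _; lra.
Qed.

Lemma boundary_open x : boundary Omega x <-> closure Omega x /\ ~ Omega x.
Proof. by rewrite /boundary ((interior_id Omega).1 oO). Qed.

(** Test function b . y - d |y|^2: its gradient cannot vanish on the domain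
    because |b| = 3 d M exceeds 2 d |y|, its infinity Laplacian is - 2 d < 0,
    and its size is O(d). *)
Lemma maximum_principle (w : 'rV[R]_n.+1 -> R) G :
    subsolution Omega 0 w -> {within closure Omega, continuous w} ->
    (forall x, boundary Omega x -> w x <= G) ->
  forall x, closure Omega x -> w x <= G.
Proof.
move=> sub wC wG x cx; apply/ler_addgt0Pr => e e0.
have [M M0 MO] := enorm_closure_bounded.
have M2 : 0 < M ^+ 2 by rewrite exprn_gt0.
pose d := e / (8 * M ^+ 2).
have d0 : 0 < d by rewrite divr_gt0// mulr_gt0.
pose b : 'rV[R]_n.+1 := (3 * d * M) *: delta_mx 0 0.
have nb : enorm b = 3 * d * M.
  rewrite enormZ /enorm dotv_delta mxE !eqxx sqrtr1 mulr1 gtr0_norm//.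
  by do 2!rewrite mulr_gt0//.
pose phi y := dotv b y - d * enorm (y - 0) ^+ 2.
have phiE y : phi y = dotv b y - d * dotv y y by rewrite /phi subr0 sqr_enorm.
have phiC : continuous phi.
  move=> y; apply: (@cvgB _ _ _ (nbhs y)); first exact: dotv_continuous.
  apply: (@cvgM _ _ (nbhs y)); first exact: cvg_cst.
  apply: (@continuous_comp _ _ _ (fun y : 'rV[R]_n.+1 => enorm (y - 0))
    (fun r => r ^+ 2)); [exact: enorm_dist_continuous|exact: exprn_continuous].
have [y0] : exists2 y0, y0 \in closure Omega &
    forall t, t \in closure Omega -> w t - phi t <= w y0 - phi y0.
  apply: (@compact_EVT_max _ _ (fun t => w t - phi t)).
  - by exists x.
  - exact: compact_closure_domain.
  - by move=> y; apply: cvgB; [exact: wC|exact: (continuous_subspaceT phiC)].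
rewrite inE => cy0 y0max.
have phi_le y : closure Omega y -> `|phi y| <= 4 * d * M ^+ 2.
  move=> cy; have yM := MO _ cy; have y_ge0 := enorm_ge0 y.
  have h1 := cauchy_schwarz b y; have h2 := cauchy_schwarz (- b) y.
  have dM : 0 < d * M by rewrite mulr_gt0.
  have h3 : d * M * enorm y <= d * M * M by rewrite (ler_pM2l dM).
  have h4 : d * enorm y ^+ 2 <= d * M ^+ 2.
    by rewrite (ler_pM2l d0) ler_sqr ?nnegrE// ltW.
  have h5 : 0 <= d * enorm y ^+ 2 by rewrite mulr_ge0 ?sqr_ge0 ?ltW.
  move: h1 h2; rewrite phiE -sqr_enorm dotvNl enormN nb => h1 h2.
  by rewrite ler_norml; apply/andP; split; lra.
have wy0 : w y0 <= G.
  apply: wG; apply/boundary_open; split=> // Oy0.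
  have p0 : b - (2 * d) *: y0 != 0.
    apply/eqP => /subr0_eq /(congr1 (@enorm _ _)); rewrite nb enormZ.
    rewrite ger0_norm; last by lra.
    have : d * enorm y0 <= d * M by rewrite (ler_pM2l d0) MO.
    have : 0 < d * M by exact: mulr_gt0.
    lra.
  have /(sub _ _ (- d) 0 Oy0 p0) : \forall y \near y0,
      w y <= paraboloid y0 (w y0) (b - (2 * d) *: y0) (- d) 0 y.
    have : nbhs y0 Omega by apply: open_nbhs_nbhs.
    apply: filterS => y /subset_closure Oy.
    have := y0max _ (mem_set Oy); rewrite /paraboloid !phiE.
    by rewrite !dotvE (dotvC y0 y); lra.
  lra.
have := y0max _ (mem_set cx); have := phi_le _ cx; have := phi_le _ cy0.
have -> : 4 * d * M ^+ 2 = e / 2 by rewrite /d; field; rewrite gt_eqF.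
rewrite !ler_norml => /andP[? ?] /andP[? ?]; lra.
Qed.

(** The first parameter at which the segment is outside Omega gives a point
    outside the open set Omega and in its closure. *)
Lemma segment_meets_boundary x y : Omega x -> ~ Omega y ->
  exists2 t : R, 0 <= t <= 1 & boundary Omega (x + t *: (y - x)).
Proof.
move=> Ox nOy; pose pt (t : R) := x + t *: (y - x).
have ptB s t : enorm (pt s - pt t) = `|s - t| * enorm (y - x).
  by rewrite -enormZ /pt opprD addrACA subrr add0r scalerBl.
pose S := [set t : R | 0 <= t <= 1 /\ ~ Omega (pt t)].
have S1 : S 1 by split; [rewrite ler01 lexx|rewrite /pt scale1r addrC subrK].
have lbS : lbound S 0 by move=> t [/andP[]].
have infS : has_inf S by split; [exists 1|exists 0].
set t0 := inf S.
have t00 : 0 <= t0 by apply: lb_le_inf => //; exists 1.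
have t01 : t0 <= 1 by apply: ge_inf => //; exists 0.
have yx1 : 0 < enorm (y - x) + 1 by rewrite ltr_wpDl ?enorm_ge0.
have close s e : 0 < e -> `|s - t0| <= e / (enorm (y - x) + 1) ->
    enorm (pt s - pt t0) <= e.
  move=> e0; rewrite ler_pdivlMr// => h; rewrite ptB; apply: le_trans h.
  by rewrite ler_wpM2l// lerDl.
have nOt0 : ~ Omega (pt t0).
  move=> Ot0; have [e e0 eO] := nbhs_enorm (open_nbhs_nbhs (conj oO Ot0)).
  have d0 : 0 < e / (enorm (y - x) + 1) by rewrite divr_gt0.
  have [s Ss st0] := inf_adherent d0 infS.
  apply: Ss.2; apply: eO; apply: close => //.
  have : t0 <= s by apply: ge_inf => //; exists 0.
  by move: st0; rewrite -/t0 => ? ?; rewrite ger0_norm; lra.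
exists t0; first by rewrite t00 t01.
apply/boundary_open; split=> // B /nbhs_enorm[e e0 eB].
have t0_gt0 : 0 < t0.
  rewrite lt_neqAle t00 andbT; apply/eqP => t0E; apply: nOt0.
  by rewrite -t0E /pt scale0r addr0.
have d0 : 0 < e / (enorm (y - x) + 1) by rewrite divr_gt0.
pose s := Num.max 0 (t0 - e / (enorm (y - x) + 1)).
have st0 : s < t0 by rewrite gt_max t0_gt0/=; lra.
have s0 : 0 <= s by rewrite le_max lexx.
exists (pt s); split.
  apply: contrapT => nOs; have : t0 <= s; last by lra.
  apply: ge_inf; first by exists 0.
  by split=> //; rewrite s0/=; lra.
apply: eB; apply: close => //.
have : t0 - e / (enorm (y - x) + 1) <= s by rewrite le_max lexx orbT.
by rewrite ler0_norm; lra.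
Qed.

Lemma near_boundary x (r : R) : Omega x -> ~ (eball x r `<=` Omega) ->
  exists2 y, boundary Omega y & eball x r y.
Proof.
move=> Ox /existsNP[y /not_implyP[xy nOy]].
have [t /andP[t0 t1] bt] := segment_meets_boundary Ox nOy.
exists (x + t *: (y - x)) => //; rewrite /eball /= addrAC subrr add0r enormZ.
rewrite ger0_norm//; apply: le_trans xy.
by rewrite ler_piMl// enorm_ge0.
Qed.

Lemma boundary_nonempty : Omega !=set0 -> boundary Omega !=set0.
Proof.
move=> [x Ox]; have [M M0 MO] := enorm_closure_bounded.
have [|t _ bt] := @segment_meets_boundary x ((M + 1) *: delta_mx 0 0) Ox.
  move=> /subset_closure/MO; rewrite enormZ /enorm dotv_delta mxE !eqxx sqrtr1.
  by rewrite mulr1 ger0_norm; lra.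
by eexists; exact: bt.
Qed.

End Domain.

Section UniformContinuity.
Context (R : realType) (n : nat).

Lemma compact_uniform_continuity (K : set 'rV[R]_n.+1) (f : 'rV[R]_n.+1 -> R)
    (e : R) :
    compact K -> {within K, continuous f} -> 0 < e ->
  exists2 d : R, 0 < d &
    forall x y, K x -> K y -> enorm (y - x) <= d -> `|f x - f y| <= e.
Proof.
move=> /compact_near_coveringP/near_covering_withinP Kcov fC e0.
have := Kcov R 0^'+ (fun d x => forall y, K y -> enorm (y - x) <= d ->
  `|f x - f y| <= e).
move=> /(_ (at_right_proper_filter 0)) H.
have {}H : \forall d \near 0^'+, K `<=` (fun x => forall y : 'rV[R]_n.+1, K y ->
    enorm (y - x) <= d -> `|f x - f y| <= e).
  apply: H => x Kx.
  have e20 : 0 < e / 2 by rewrite divr_gt0.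
  have : within K (nbhs x) (f @^-1` ball (f x) (e / 2)).
    by rewrite (nbhs_subspace_in Kx); apply: (fC x); exact: nbhsx_ballx.
  move=> /(nbhs_enorm (x := x))[r r0 rP].
  have r20 : 0 < r / 2 by rewrite divr_gt0.
  near=> x' d => /= Kx' y Ky x'y.
  have xx' : enorm (x' - x) < r / 2 by near: x'; exact: near_enorm.
  have dr : d <= r / 2 by near: d; exact: nbhs_right_le.
  have hx' : `|f x - f x'| < e / 2.
    by apply: rP => //; apply: ltW; apply: lt_trans xx' _; lra.
  have hy : `|f x - f y| < e / 2.
    apply: rP => //; have -> : r = r / 2 + r / 2 by field.
    apply: eball_trans (ltW xx') _; exact: le_trans x'y dr.
  have := ler_distD (f x) (f x') (f y); rewrite (distrC (f x') (f x)) => h.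
  by apply: le_trans h _; lra.
near (0 : R)^'+ => d.
exists d => // x y Kx Ky; move: x Kx y Ky.
have : K `<=` (fun x => forall y : 'rV[R]_n.+1, K y ->
    enorm (y - x) <= d -> `|f x - f y| <= e) by near: d.
by move=> Kd x Kx y Ky; exact: Kd.
Unshelve. all: by end_near. Qed.

End UniformContinuity.

(** * From Lipschitz paths to chains of short steps *)

Section PathChains.
Context (R : realType) (n : nat).
Implicit Types (x y : 'rV[R]_n.+1) (e : R).

(** Merging consecutive steps as long as they fit in length e leaves a chain
    in which two consecutive steps always have total length more than e, hence
    the factor 2. *)
Lemma polygon_chain (f : nat -> 'rV[R]_n.+1) m e : 0 < e ->
    (forall i, (i < m)%N -> enorm (f i.+1 - f i) <= e) ->
  exists2 k, chain (fun x => eball x e) k (f 0) (f m) &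
    e * k%:R <= 2 * (\sum_(0 <= i < m) enorm (f i.+1 - f i)) + e.
Proof.
move=> e0 fe.
(* Counting the first step by its length and the other ones by e is the
   invariant that survives adding a vertex in front. *)
suff [k [q [fq c le]]] : exists k q, [/\ eball (f 0) e q,
    chain (fun x => eball x e) k q (f m) &
    e * k%:R + enorm (q - f 0) <= 2 * (\sum_(0 <= i < m) enorm (f i.+1 - f i))].
  exists k.+1; first by exists q.
  by have := enorm_ge0 (q - f 0); rewrite -natr1 mulrDr mulr1; lra.
elim: m f fe => [|m IH] f fe.
  exists 0%N, (f 0%N); split=> //; first by rewrite /eball /= subrr enorm0 ltW.
  by rewrite subrr enorm0 big_geq//; lra.
have [//|k [q [fq c le]]] := IH (fun i => f i.+1).
  by move=> i im; exact: fe.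
rewrite big_nat_recl//; have f1 := fe 0%N isT.
have tri := ler_enorm_dist (f 1%N) q (f 0%N).
have [short|long] := leP (enorm (f 1%N - f 0%N) + enorm (q - f 1%N)) e.
  exists k, q; split=> //; first by rewrite /eball /=; lra.
  by have := enorm_ge0 (f 1%N - f 0%N); lra.
exists k.+1, (f 1%N); split=> //; first by exists q.
by rewrite -natr1 mulrDr mulr1; lra.
Qed.

Lemma lipschitz_path_chain (A : set 'rV[R]_n.+1) x y p (L e : R) :
    lipschitz_path A x y p -> (path_length p < L%:E)%E -> 0 < e ->
  exists2 k, chain (fun x => eball x e) k x y & e * k%:R <= 2 * L + e.
Proof.
move=> [[c cp] _ p0 p1] pL e0.
pose C := n.+1%:R * `|c|.
have C0 : 0 <= C by rewrite mulr_ge0.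
have pC s t : 0 <= s <= 1 -> 0 <= t <= 1 -> enorm (p s - p t) <= C * `|s - t|.
  move=> s01 t01; apply: le_trans (enorm_le_norm _) _.
  rewrite -mulrA ler_wpM2l//.
  have := cp (s, t); rewrite /= !in_itv /= => /(_ (conj s01 t01)) h.
  by apply: le_trans h _; rewrite ler_wpM2r// ler_norm.
(* A uniform subdivision fine enough for the Lipschitz constant. *)
pose m := (Num.truncn (C / e)).+1.
have m0 : 0 < m%:R :> R by rewrite ltr0n.
have Cm : C / m%:R <= e.
  rewrite ler_pdivrMr// mulrC -ler_pdivrMr//; apply/ltW.
  exact: truncnS_gt.
pose s : seq R := [seq i.+1%:R / m%:R | i <- iota 0 m].
have ss : size s = m by rewrite size_map size_iota.
have ns k : (k <= m)%N -> nth 1 (0 :: s) k = k%:R / m%:R.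
  case: k => [|k] km; first by rewrite mul0r.
  by rewrite /= (nth_map 0%N) ?size_iota// nth_iota.
have part : itv_partition 0 1 s.
  split.
    apply/(pathP 1) => i; rewrite ss => im.
    have := ns i (ltnW im); have := ns i.+1 im => /= -> ->.
    by rewrite ltr_pM2r ?invr_gt0// ltr_nat.
  by rewrite (last_nth 1) ss ns// divff// gt_eqF.
pose f k := p (k%:R / m%:R).
have fE k : (k <= m)%N -> (p \o nth 1 (0 :: s)) k = f k by move=> km; rewrite /= ns.
have i01 k : (k <= m)%N -> 0 <= (k%:R / m%:R : R) <= 1.
  by move=> km; rewrite divr_ge0//= ler_pdivrMr// mul1r ler_nat.
have fe i : (i < m)%N -> enorm (f i.+1 - f i) <= e.
  move=> im; apply: le_trans Cm.
  apply: le_trans (pC _ _ (i01 _ im) (i01 _ (ltnW im))) _.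
  by rewrite -mulrBl -natrB// subSnn mul1r ger0_norm.
have [k] := polygon_chain e0 fe.
rewrite /f mul0r divff ?gt_eqF// p0 p1 => ck le; exists k => //.
apply: le_trans le _; rewrite lerD2r ler_wpM2l//.
have -> : \sum_(0 <= i < m) enorm (f i.+1 - f i) = polygon_length p s.
  rewrite /polygon_length ss; apply: eq_big_nat => i /andP[_ im].
  by rewrite !fE// ltnW.
rewrite -lee_fin; apply: le_trans (ltW pL).
by apply: ereal_sup_ubound; exists s.
Qed.

(** The unit added to the path diameter is the slack of an infimum over paths. *)
Lemma path_diam_chain (Omega : set 'rV[R]_n.+1) x y e :
    (path_diam Omega < +oo)%E -> closure Omega x -> closure Omega y -> 0 < e ->
  exists2 k, chain (fun x => eball x e) k x y &
    e * k%:R <= 2 * (fine (path_diam Omega) + 1) + e.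
Proof.
move=> fin cx cy e0.
have dL : (path_dist (closure Omega) x y < (fine (path_diam Omega) + 1)%:E)%E.
  apply: (@le_lt_trans _ _ (path_diam Omega)).
    by apply: ereal_sup_ubound; exists x, y.
  case: (path_diam Omega) fin => [r _|//|_]; last exact: ltNyr.
  by rewrite lte_fin /= ltrDl.
have [_ [p lp <-] pL] := ereal_inf_lt dL.
exact: lipschitz_path_chain lp pL e0.
Qed.

End PathChains.

(** * The comparison estimate and the theorem *)

Section Comparison.
Context (R : realType) (n : nat) (Omega : set 'rV[R]_n.+1).
Hypotheses (oO : open Omega) (bO : bounded_set Omega).

(** The number L bounds the length of an e-chain out of Omega.  At scale e the
    steepening has slope s = sigma e and kappa = 4 gamma / sigma^2, so that
    kappa s^2 / 2 = 2 gamma e^2 beats the defect gamma e^2 of u. *)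
Lemma comparison_estimate (u v : 'rV[R]_n.+1 -> R) (gamma sigma G L : R) :
    0 < gamma -> 0 < sigma ->
    subsolution Omega gamma u -> subsolution Omega 0 (\- v) ->
    {within closure Omega, continuous u} ->
    {within closure Omega, continuous v} ->
    (forall x, boundary Omega x -> u x = v x) ->
    (forall x, closure Omega x -> `|v x| <= G) ->
    (forall x e, Omega x -> 0 < e -> e <= 1 ->
       exists k y, [/\ chain (fun x => eball x e) k x y, ~ Omega y
                     & e * k%:R <= L]) ->
  forall x, Omega x ->
    u x - v x <= 2 * sigma * L
      + 2 * (4 * gamma / sigma ^+ 2) * (G + 2 * sigma * L) ^+ 2.
Proof.
move=> g0 s0 subu subv uC vC uv vG exits x Ox.
rewrite lerBlDl; apply/ler_addgt0Pr => d d0.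
have d20 : 0 < d / 2 by rewrite divr_gt0.
have cptO := compact_closure_domain bO.
have [du du0 uUC] := compact_uniform_continuity cptO uC d20.
have [dv dv0 vUC] := compact_uniform_continuity cptO vC d20.
have [r r0 xrO] := nbhs_enorm (open_nbhs_nbhs (conj oO Ox)).
pose e := Num.min (Num.min 1 r) (Num.min (du / 3) (dv / 3)).
have e0 : 0 < e by rewrite !lt_min ltr01 r0 !divr_gt0.
have [e1 er eu ev] : [/\ e <= 1, e <= r, 3 * e <= du & 3 * e <= dv].
  have : e <= e by [].
  rewrite {2}/e !le_min => /andP[/andP[-> ->]] /andP[? ?].
  by split=> //; lra.
have e0' := ltW e0.
pose N (y : 'rV[R]_n.+1) := eball y e.
pose Y := [set y | eball y e `<=` Omega].
pose I := [set y | eball y (2 * e) `<=` Omega].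
have yy (y : 'rV[R]_n.+1) t : 0 <= t -> eball y t y.
  by rewrite /eball /= subrr enorm0.
have IY y : I y -> Y y.
  by move=> Iy z yz; apply: Iy; move: yz; rewrite /eball /=; lra.
have NY y z : I y -> N y z -> Y z.
  move=> Iy yz t zt; apply: Iy; have -> : 2 * e = e + e by ring.
  exact: eball_trans yz zt.
have YO y : Y y -> Omega y by apply; exact: yy.
have OC : Omega `<=` closure Omega by exact: subset_closure.
have uO : {within Omega, continuous u} := continuous_subspaceW OC uC.
have wC : {within closure Omega, continuous (\- v)}.
  by move=> y; apply: cvgN; exact: vC.
have wO : {within Omega, continuous (\- v)} := continuous_subspaceW OC wC.
pose U := ball_sup u e; pose V y := - ball_sup (\- v) e y.
have UE y : Y y -> (exists2 z, eball y e z & U y = u z) /\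
    forall z, eball y e z -> u z <= U y.
  by move=> Yy; apply: ball_sup_attained => //; exact: continuous_subspaceW uO.
have VE y : Y y -> (exists2 z, eball y e z & V y = v z) /\
    forall z, eball y e z -> V y <= v z.
  move=> Yy; have [] := ball_sup_attained e0' (continuous_subspaceW Yy wO).
  move=> [z yz E] H; split; first by exists z => //; rewrite /V E opprK.
  by move=> t /H /=; rewrite /V; lra.
have VG y : Y y -> `|V y| <= G.
  by move=> Yy; have [[z yz ->] _] := VE _ Yy; apply: vG; exact/OC/Yy.
have superV y : I y -> exists2 z, N y z &
    forall t, N y t -> V z <= V t /\ V z + V t <= 2 * V y.
  move=> Iy; have [z yz H] := ball_sup_finite_difference subv (lexx 0) wO e0 Iy.
  by exists z => // t /H[? ?]; rewrite /V; split; lra.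
pose K := Num.truncn (L / e).
have L0 : 0 <= L.
  by have [k [y [_ _]]] := exits _ _ Ox e0 e1; apply: le_trans; rewrite mulr_ge0.
have Le : e * K%:R <= L.
  by rewrite mulrC -ler_pdivlMr// truncn_le// divr_ge0.
have exitsI y : Y y -> exists2 k, (k <= K)%N & exists2 z, chain N k y z & ~ I z.
  move=> Yy; have [k [z [c nOz kL]]] := exits _ _ (YO _ Yy) e0 e1.
  exists k; first by rewrite truncn_ge_nat ?divr_ge0// ler_pdivlMr// mulrC.
  by exists z => // /IY/YO.
have se0 : 0 <= sigma * e by rewrite mulr_ge0// ltW.
have Nsym y z : N y z -> N z y by exact: eball_sym.
have Vlb y : Y y -> - G <= V y by move=> /VG; rewrite ler_norml => /andP[].
have [F [VF FV Fsteep]] := steepening Nsym IY NY se0 Vlb superV exitsI.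
have sK : 2 * (sigma * e) * K%:R <= 2 * sigma * L.
  have -> : 2 * (sigma * e) * K%:R = 2 * sigma * (e * K%:R) by ring.
  by rewrite ler_wpM2l// mulr_ge0// ltW.
have FB y : Y y -> `|F y| <= G + 2 * sigma * L.
  move=> Yy; have /andP[? ?] := VF _ Yy; have := VG _ Yy.
  by rewrite !ler_norml => /andP[? ?]; apply/andP; split; lra.
pose kappa := 4 * gamma / sigma ^+ 2.
have k0 : 0 <= kappa by rewrite divr_ge0 ?sqr_ge0// mulr_ge0// ltW.
have kgap : gamma * e ^+ 2 < kappa * (sigma * e) ^+ 2 / 2.
  have -> : kappa * (sigma * e) ^+ 2 / 2 = 2 * (gamma * e ^+ 2).
    by rewrite /kappa; field; rewrite gt_eqF.
  have : 0 < gamma * e ^+ 2 by rewrite mulr_gt0// exprn_gt0.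
  lra.
have Ubd : exists b, forall y, Y y -> U y <= b.
  have [|y _ ymax] := compact_EVT_max _ cptO uC; first by exists x; exact: OC.
  exists (u y) => z /[dup] Yz /UE[[t zt ->] _]; apply: ymax; apply/mem_set.
  exact/OC/Yz.
have subU y : I y -> exists2 z, N y z &
    forall t, N y t -> 2 * U y - gamma * e ^+ 2 <= U z + U t.
  move=> Iy; have [z yz H] := ball_sup_finite_difference subu (ltW g0) uO e0 Iy.
  by exists z => // t /H[].
(* In the boundary layer the two balls of radius e lie within 3 e of a common
   boundary point, where u = v. *)
have UVbd y : Y y -> ~ I y -> U y <= F y + d.
  move=> Yy nIy; have [b bb yb] := near_boundary oO (YO _ Yy) nIy.
  have cb : closure Omega b by have [] := (boundary_open oO b).1 bb.
  have [[z yz ->] _] := UE _ Yy; rewrite (FV _ nIy).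
  have [[t yt ->] _] := VE _ Yy.
  have dist w : eball y e w -> eball b (3 * e) w.
    have -> : 3 * e = 2 * e + e by ring.
    by move=> yw; apply: eball_trans yw; exact: eball_sym.
  have : `|u b - u z| <= d / 2.
    by apply: uUC => //; [exact/OC/Yy|exact: le_trans (dist _ yz) eu].
  have : `|v b - v t| <= d / 2.
    by apply: vUC => //; [exact/OC/Yy|exact: le_trans (dist _ yt) ev].
  by rewrite (uv _ bb) !ler_norml => /andP[? ?] /andP[? ?]; lra.
have Yx : Y x by move=> y xy; apply: xrO; exact: le_trans xy er.
have := discrete_comparison NY k0 kgap se0 Ubd FB subU Fsteep UVbd Yx.
have := (UE _ Yx).2 _ (yy _ _ e0'); have := (VE _ Yx).2 _ (yy _ _ e0').
have /andP[_] := VF _ Yx.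
by rewrite -/kappa; lra.
Qed.

End Comparison.

(* The bound gamma <= 1 is needed: on Omega = ]-1, 1[ with g = 0 one has
   u_gamma(x) = gamma * (1 - x^2) / 2, whose sup norm gamma / 2 is not
   O(gamma^(1/3)) as gamma tends to infinity. *)
Theorem theorem2p19 (R : realType) :
  exists C : R -> R, (forall D : R, 0 < C D) /\
    forall (n : nat) (Omega : set 'rV[R]_n.+1),
      Omega !=set0 -> open Omega -> connected Omega -> bounded_set Omega ->
      (path_diam Omega < +oo)%E ->
    forall g : 'rV[R]_n.+1 -> R,
      {within boundary Omega, continuous g} ->
    forall u : R -> 'rV[R]_n.+1 -> R,
      (forall gamma : R, 0 <= gamma -> dirichlet_solution Omega g gamma (u gamma)) ->
    forall gamma : R, 0 <= gamma -> gamma <= 1 ->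
      supnorm (closure Omega) (u gamma \- u 0)
        <= C (fine (path_diam Omega)) * gamma `^ (1 / 3)
           * (1 + supnorm (boundary Omega) g).
Proof.
pose ell (D : R) := 2 * (`|D| + 1) + 1.
have ell0 D : 0 < ell D by rewrite /ell; have := normr_ge0 D; lra.
exists (fun D => 2 * ell D + 8 * (1 + 2 * ell D) ^+ 2); split.
  by move=> D; have := ell0 D; have := sqr_ge0 (1 + 2 * ell D); lra.
move=> n Omega O0 oO _ bO diam g _ u sol gamma g0 g1.
set L := ell _; set G := supnorm _ g.
have L0 : 0 < L by exact: ell0.
have [ugC ug_visc ug_g] := sol _ g0; have [u0C u0_visc u0_g] := sol _ (lexx 0).
have cptO := compact_closure_domain bO.
have [b bb] := boundary_nonempty oO bO O0.
have bC x : boundary Omega x -> closure Omega x by case.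
have c0 : closure Omega !=set0 by exists b; exact: bC.
have gG x : boundary Omega x -> `|g x| <= G.
  move=> bx; apply: ub_le_sup; last by exists x.
  have nC : {within closure Omega, continuous (fun x => `|u 0 x|)}.
    by move=> y; apply: cvg_norm; exact: u0C.
  have [z _ zmax] := compact_EVT_max c0 cptO nC.
  by exists `|u 0 z| => _ [y by_ <-]; rewrite -u0_g//; apply/zmax/mem_set/bC.
have G0 : 0 <= G by apply: le_trans (gG _ bb); exact: normr_ge0.
have sub0 : subsolution Omega 0 (u 0) := viscosity_subsolution u0_visc.
have super0 : subsolution Omega 0 (\- u 0).
  by have := viscosity_supersolution u0_visc; rewrite oppr0.
have Nu0C : {within closure Omega, continuous (\- u 0)}.
  by move=> y; apply: cvgN; exact: u0C.
have NugC : {within closure Omega, continuous (\- u gamma)}.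
  by move=> y; apply: cvgN; exact: ugC.
have u0G x : closure Omega x -> `|u 0 x| <= G.
  move=> cx; rewrite ler_norml; apply/andP; split.
    rewrite lerNl; move: x cx; apply: (maximum_principle oO bO super0 Nu0C).
    move=> x bx; rewrite /= u0_g//; have := gG _ bx.
    by rewrite ler_norml => /andP[? ?]; lra.
  move: x cx; apply: (maximum_principle oO bO sub0 u0C) => x bx.
  by rewrite u0_g//; apply: le_trans (gG _ bx); exact: ler_norm.
have exits x e : Omega x -> 0 < e -> e <= 1 ->
    exists k y, [/\ chain (fun x => eball x e) k x y, ~ Omega y
                  & e * k%:R <= L].
  move=> Ox e0 e1.
  have [k c le] := path_diam_chain diam (subset_closure Ox) (bC _ bb) e0.
  exists k, b; split=> //; first by have [] := (boundary_open oO b).1 bb.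
  by apply: le_trans le _; rewrite /L /ell;
    have := ler_norm (fine (path_diam Omega)); lra.
rewrite -/L; set c := gamma `^ (1 / 3); set bound := (X in _ <= X).
have c_ge0 : 0 <= c by exact: powR_ge0.
have bound0 : 0 <= bound.
  apply: mulr_ge0; last by lra.
  by apply: mulr_ge0 => //; have := sqr_ge0 (1 + 2 * L); lra.
apply: ge_sup; first by move: c0 => [x cx]; exists `|(u gamma \- u 0) x|, x.
move=> _ [x cx <-].
have [gE|gN0] := eqVneq gamma 0; first by rewrite gE /= subrr normr0.
have {gN0} g0' : 0 < gamma by rewrite lt_neqAle eq_sym gN0.
have c_gt0 : 0 < c by rewrite powR_gt0.
have c3 : gamma = c ^+ 3.
  by rewrite -powR_mulrn// -powRrM div1r mulVf// powRr1// ltW.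
have c1 : c <= 1.
  rewrite leNgt; apply/negP => c1; have : 1 < c ^+ 3 by rewrite exprn_egt1.
  by rewrite -c3 ltNge g1.
pose sigma := c * (1 + G).
have G1 : 0 < 1 + G by lra.
have s0 : 0 < sigma by rewrite mulr_gt0.
(* With c = gamma^(1/3), 4 gamma / sigma^2 = 4 c / (1 + G)^2, and c <= 1 bounds
   the range G + 2 sigma L of the steepened function by (1 + G) (1 + 2 L). *)
have estimate : 2 * sigma * L
    + 2 * (4 * gamma / sigma ^+ 2) * (G + 2 * sigma * L) ^+ 2 <= bound.
  pose beta := (G + 2 * sigma * L) / (1 + G).
  have -> : 2 * (4 * gamma / sigma ^+ 2) * (G + 2 * sigma * L) ^+ 2
      = 8 * c * beta ^+ 2.
    by rewrite c3 /beta /sigma; field; rewrite !gt_eqF.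
  have beta0 : 0 <= beta by rewrite divr_ge0 ?addr_ge0 ?mulr_ge0// ltW.
  have cL : c * L <= L by rewrite ler_piMl// ltW.
  have beta1 : beta <= 1 + 2 * L.
    rewrite ler_pdivrMr// /sigma.
    have : 0 <= (L - c * L) * (1 + G).
      by apply: mulr_ge0; [rewrite subr_ge0|exact: ltW].
    lra.
  have beta2 : c * beta ^+ 2 <= c * (1 + 2 * L) ^+ 2.
    by rewrite ler_wpM2l// ler_sqr// nnegrE; lra.
  have : 0 <= c * (1 + 2 * L) ^+ 2 * G.
    by apply: mulr_ge0 => //; apply: mulr_ge0 => //; exact: sqr_ge0.
  by rewrite /bound /sigma; lra.
have [Ox|nOx] := pselect (Omega x); last first.
  have bx : boundary Omega x by apply/boundary_open.
  by rewrite /= ug_g// u0_g// subrr normr0.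
apply: le_trans estimate.
have subg := viscosity_subsolution ug_visc.
have superg : subsolution Omega gamma (\- u gamma).
  by apply: subsolution_le (viscosity_supersolution ug_visc); lra.
have sub0' : subsolution Omega 0 (\- (\- u 0)).
  by have -> : \- (\- u 0) = u 0 by apply/funext => y /=; rewrite opprK.
rewrite ler_norml; apply/andP; split; last first.
  apply: (comparison_estimate oO bO g0' s0 subg super0 ugC u0C _ u0G exits) => //.
  by move=> y yb; rewrite ug_g// u0_g.
have Nuv y : boundary Omega y -> (\- u gamma) y = (\- u 0) y.
  by move=> yb; rewrite /= ug_g// u0_g.
have Nu0G y : closure Omega y -> `|(\- u 0) y| <= G.
  by move=> /u0G; rewrite /= normrN.
have := comparison_estimate oO bO g0' s0 superg sub0' NugC Nu0C Nuv Nu0G exits Ox.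
by rewrite /=; lra.
Qed.
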